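(* Let $V$ be a unital JB-algebra and let $x\in V$. Then $\sigma(U_x)\subset(0,+\infty)$ if and only if $x=v\circ\varepsilon$ for some positive element $v\in\Omega$ and some central symmetry $\varepsilon$ of $V$.
   Context: A (unital) JB-algebra is a real Jordan algebra $(V,\circ)$ with unit $1$ (the product is bilinear, commutative and $x^2\circ(x\circ y)=x\circ(x^2\circ y)$) with a complete norm such that $\|x\circ y\|\le\|x\|\|y\|$, $\|x^2\|=\|x\|^2$, $\|x^2\|\le\|x^2+y^2\|$; it may be infinite dimensional. $B(V)$ is the algebra of bounded real-linear operators on $V$. $L_xy=x\circ y$ and $U_x=2L_x^2-L_{x^2}\in B(V)$. An element $x$ is invertible if there is $y$ with $U_xy=x$ and $U_xy^2=1$ (equivalently $U_x$ is an invertible operator). $\sigma(x)=\{\lambda\in\mathbb R: x-\lambda 1\text{ is not invertible}\}$ and $\Omega=\{x\in V:\sigma(x)\subset(0,+\infty)\}$ is the cone of positive elements. For $T\in B(V)$, $\sigma(T)=\{t\in\mathbb R: T-t\,\mathrm{Id}\text{ is not invertible in }B(V)\}$. An element $z$ is central if $L_z$ commutes with $L_w$ for all $w\in V$. A central projection is a central $p$ with $p^2=p$; a central symmetry is an element of the form $\varepsilon_p=2p-1$ with $p$ a central projection. *)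

(* Defs.v *)
From HB Require Import structures.
From mathcomp Require Import all_boot all_order all_algebra.
From mathcomp Require Import all_classical all_reals all_analysis.

Set Implicit Arguments.
Unset Strict Implicit.
Unset Printing Implicit Defensive.

Import Order.TTheory GRing.Theory Num.Theory.
Import numFieldNormedType.Exports.

Local Open Scope classical_set_scope.
Local Open Scope ring_scope.

(* Unital JB-algebras over the real numbers R; the zero algebra is allowed. *)
HB.mixin Record isJBAlgebra (R : realType) V of CompleteNormedModule R V := {
  jmul : V -> V -> V;
  jone : V;
  jmul_bilinear : bilinear_for *:%R *:%R jmul;
  jmulC : commutative jmul;
  jmul1 : left_id jone jmul;
  jmul_jordan : forall x y : V,
    jmul (jmul x x) (jmul x y) = jmul x (jmul (jmul x x) y);
  jnormM : forall x y : V, `|jmul x y| <= `|x| * `|y|;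
  jnorm_sqr : forall x : V, `|jmul x x| = `|x| ^+ 2;
  jnorm_sqrD : forall x y : V, `|jmul x x| <= `|jmul x x + jmul y y|
}.

#[short(type="jbAlgebraType")]
HB.structure Definition JBAlgebra (R : realType) :=
  {V of isJBAlgebra R V & CompleteNormedModule R V}.

Notation "x *J y" := (jmul x y) (at level 40, left associativity) : ring_scope.

Section BoundedOperators.
Context {R : realType} {V : normedModType R}.

(* B(V), as a set of maps. *)
Definition bounded_operator : set (V -> V) :=
  [set T | linear T /\ exists M : R, forall y, `|T y| <= M * `|y|].

Definition invertible_operator (T : V -> V) : Prop :=
  bounded_operator T /\
  exists S, [/\ bounded_operator S, S \o T = id & T \o S = id].

Definition operator_spectrum (T : V -> V) : set R :=
  [set t | ~ invertible_operator (fun y => T y - t *: y)].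

End BoundedOperators.

Section JBTheory.
Context {R : realType} {V : jbAlgebraType R}.
Implicit Types x y z v p e : V.

Definition jL x : V -> V := fun y => x *J y.

Definition jU x : V -> V := fun y => 2 *: jL x (jL x y) - jL (x *J x) y.

Definition jinvertible x : Prop :=
  exists y, jU x y = x /\ jU x (y *J y) = jone.

Definition jspectrum x : set R := [set t | ~ jinvertible (x - t *: jone)].

(* The cone Omega. *)
Definition positive_cone : set V := [set x | jspectrum x `<=` `]0, +oo[].

Definition central z : Prop := forall w : V, jL z \o jL w = jL w \o jL z.

Definition central_projection p : Prop := central p /\ p *J p = p.

Definition central_symmetry e : Prop :=
  exists2 p, central_projection p & e = 2 *: p - jone.

Lemma jL_bounded x : bounded_operator (jL x).
Proof.
by split; [exact: (jmul_bilinear.2 x) | exists `|x| => y; exact: jnormM].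
Qed.

Lemma jU_bounded x : bounded_operator (jU x).
Proof.
have [Ll _] := jL_bounded x; have [Ls _] := jL_bounded (x *J x).
split=> [a y z|].
  by rewrite /jU !Ll Ls scalerDr scalerBr opprD addrACA !scalerA mulrC.
exists (2 * (`|x| * `|x|) + `|x *J x|) => y.
rewrite mulrDl (le_trans (ler_normB _ _))// lerD ?jnormM//.
rewrite normrZ ger0_norm// -!mulrA ler_wpM2l//.
by rewrite (le_trans (jnormM _ _))// ler_wpM2l// jnormM.
Qed.

End JBTheory.

(* Main.v *)
(** Every x lies in a closed subalgebra A (the closure of the polynomials in x)
    that is associative and whose multiplication operators commute. On A one has
    U_{ab} = U_a U_b, square roots are given by a convergent iteration, and the
    norm is the spectral radius.

    If v is positive and t > 0, put w = (t - v) / (t + v). Then |w| < 1 and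
    2 (t^2 + U_v) = U_{t+v} + U_{t-v} = U_{t+v} (1 + U_w), which is invertible
    by a Neumann series. Multiplying v by a central symmetry does not change U_v.

    Conversely, if U_x + t is invertible for all t >= 0, then x is invertible in
    A and x = v e with v = |x| and e^2 = 1. On the kernel W of L_e the operators
    L_a + L_{ea} and L_a - L_{ea} (a in A) are two commuting representations D
    and E of A with U_x = - D(v) E(v). If W were nonzero, cutting down with
    positive parts (v - c)_+ and (c - v)_+ would give approximate joint
    eigenvectors of D(v) and E(v) for some t1, t2 >= 0, so U_x + t1 t2 would not
    be bounded below. Hence L_e is injective, and then L_e^3 = L_e forces
    L_e^2 = 1, which makes e central. *)
Require Import Defs.
From HB Require Import structures.
From mathcomp Require Import all_boot all_order all_algebra.
From mathcomp Require Import all_classical all_reals all_analysis.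
From mathcomp Require Import ring lra.

Set Implicit Arguments.
Unset Strict Implicit.
Unset Printing Implicit Defensive.

Import Order.TTheory GRing.Theory Num.Theory.
Import numFieldNormedType.Exports.

Local Open Scope classical_set_scope.
Local Open Scope ring_scope.

(* The square-zero extension of R by a module V is a commutative ring, so that
   [ring] decides linear identities in V. *)
Section SquareZeroExtension.
Context {R : comNzRingType} {V : lmodType R}.

Definition sqzero : Type := (R * V)%type.

HB.instance Definition _ := GRing.Zmodule.on sqzero.

Definition sqzero_mul (p q : sqzero) : sqzero :=
  (p.1 * q.1, p.1 *: q.2 + q.1 *: p.2).

Lemma sqzero_mulA : associative sqzero_mul.
Proof.
move=> [a x] [b y] [c z]; rewrite /sqzero_mul /= mulrA; congr pair.
by rewrite !scalerDr !scalerA addrA (mulrC c a) (mulrC c b).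
Qed.

Lemma sqzero_mulC : commutative sqzero_mul.
Proof. by move=> [a x] [b y]; rewrite /sqzero_mul /= mulrC addrC. Qed.

Lemma sqzero_mul1 : left_id ((1, 0) : sqzero) sqzero_mul.
Proof. by move=> [a x]; rewrite /sqzero_mul /= mul1r scale1r scaler0 addr0. Qed.

Lemma sqzero_mulDl : left_distributive sqzero_mul +%R.
Proof.
move=> [a x] [b y] [c z]; rewrite /sqzero_mul /= mulrDl; congr pair.
by rewrite scalerDl scalerDr addrACA.
Qed.

HB.instance Definition _ := GRing.Zmodule_isComPzRing.Build sqzero
  sqzero_mulA sqzero_mulC sqzero_mul1 sqzero_mulDl.

Definition sqzero_scalar (a : R) : sqzero := (a, 0).

Lemma sqzero_scalar_is_zmod_morphism : zmod_morphism sqzero_scalar.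
Proof. by move=> a b; congr pair; rewrite subrr. Qed.

Lemma sqzero_scalar_is_monoid_morphism : monoid_morphism sqzero_scalar.
Proof.
split=> // a b; rewrite /sqzero_scalar.
by congr pair; rewrite /= !scaler0 addr0.
Qed.

HB.instance Definition _ := GRing.isZmodMorphism.Build R sqzero sqzero_scalar
  sqzero_scalar_is_zmod_morphism.
HB.instance Definition _ := GRing.isMonoidMorphism.Build R sqzero sqzero_scalar
  sqzero_scalar_is_monoid_morphism.

Definition sqzero_vec (x : V) : sqzero := (0, x).

Lemma sqzero_vec_inj : injective sqzero_vec.
Proof. by move=> x y []. Qed.

Lemma sqzero_vec0 : sqzero_vec 0 = 0. Proof. by []. Qed.

Lemma sqzero_vecD x y : sqzero_vec (x + y) = sqzero_vec x + sqzero_vec y.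
Proof. by congr pair; rewrite addr0. Qed.

Lemma sqzero_vecN x : sqzero_vec (- x) = - sqzero_vec x.
Proof. by congr pair; rewrite oppr0. Qed.

Lemma sqzero_vecZ a x : sqzero_vec (a *: x) = sqzero_scalar a * sqzero_vec x.
Proof. by congr pair; rewrite /= ?mulr0 // scale0r addr0. Qed.

Definition sqzero_vecE :=
  (sqzero_vec0, sqzero_vecD, sqzero_vecN, sqzero_vecZ).

End SquareZeroExtension.

Ltac module_ring :=
  apply: sqzero_vec_inj; rewrite !sqzero_vecE; ring.

(** * Polarized Jordan identities *)

Section JordanIdentities.
Context {R : realType} {V : jbAlgebraType R}.
Implicit Types a b c d x y z : V.

Lemma jmulDr x y z : x *J (y + z) = x *J y + x *J z.
Proof.
by have := jmul_bilinear.2 x 1 y z; rewrite scale1r => -> /=; rewrite scale1r.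
Qed.

Lemma jmulr0 x : x *J 0 = 0.
Proof. by apply: (addIr (x *J 0)); rewrite -jmulDr !add0r. Qed.

Lemma jmulZr (k : R) x y : x *J (k *: y) = k *: (x *J y).
Proof. by have := jmul_bilinear.2 x k y 0; rewrite jmulr0 !addr0. Qed.

Lemma jmulNr x y : x *J (- y) = - (x *J y).
Proof. by rewrite -scaleN1r jmulZr scaleN1r. Qed.

Lemma jmulDl x y z : (y + z) *J x = y *J x + z *J x.
Proof. by rewrite ![_ *J x]jmulC jmulDr. Qed.

Lemma jmul0r x : 0 *J x = 0.
Proof. by rewrite jmulC jmulr0. Qed.

Lemma jmulZl (k : R) x y : (k *: y) *J x = k *: (y *J x).
Proof. by rewrite ![_ *J x]jmulC jmulZr. Qed.

Lemma jmulNl x y : (- y) *J x = - (y *J x).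
Proof. by rewrite ![_ *J x]jmulC jmulNr. Qed.

Lemma jmulr1 x : x *J jone = x.
Proof. by rewrite jmulC jmul1. Qed.

Definition jmulE := (jmulDl, jmulDr, jmulZl, jmulZr, jmulNl, jmulNr,
  @jmul1 R V, jmulr1, jmul0r, jmulr0).

(** The Jordan identity is cubic in [x]. The alternating sum over [a + b + c], its pairwise sums and
    its single terms isolates the trilinear part, which is twice the left-hand side. *)
Lemma jordan_linearized a b c y :
  ((a *J b) *J (c *J y) - c *J ((a *J b) *J y)) +
  ((b *J c) *J (a *J y) - a *J ((b *J c) *J y)) +
  ((c *J a) *J (b *J y) - b *J ((c *J a) *J y)) = 0.
Proof.
pose J x := (x *J x) *J (x *J y) - x *J ((x *J x) *J y).
have J0 x : J x = 0 by rewrite /J jmul_jordan subrr.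
have : J (a + b + c) - J (a + b) - J (b + c) - J (a + c) + J a + J b + J c = 0.
  by rewrite !J0 !(subr0, addr0).
rewrite {J0}/J !jmulE (jmulC b a) (jmulC c b) (jmulC a c) => eq0.
apply: (@scalerI R V 2); first by rewrite pnatr_eq0.
by rewrite scaler0 -eq0; module_ring.
Qed.
End JordanIdentities.

(** * Continuity of bounded operators and passage to closures *)

Lemma bounded_operator_continuous (R : realType) (V : normedModType R)
  (T : V -> V) : bounded_operator T -> continuous T.
Proof.
move=> [Tlin [M TM]].
pose f : {linear V -> V} := HB.pack T (GRing.isLinear.Build R V V *:%R T Tlin).
apply: (@bounded_linear_continuous R V V f).
apply/linear_boundedP; exists M; split; first exact: num_real.
by move=> r Mr x; rewrite (le_trans (TM x))// ler_wpM2r// ltW.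
Qed.

Lemma closure_preimage (T U : topologicalType) (f : T -> U) (P : set T)
    (D : set U) :
  continuous f -> closed D -> (forall x, P x -> D (f x)) ->
  forall x, closure P x -> D (f x).
Proof.
move=> /continuous_closedP fc Dc PD x clx.
suff : (f @^-1` D) x by [].
have := fc D Dc; rewrite closure_id => ->.
by apply: closureS clx => y Py; apply: PD.
Qed.

Lemma closure_eq0 (R : realType) (V : normedModType R) (T : V -> V)
    (P : set V) : bounded_operator T -> (forall x, P x -> T x = 0) ->
  forall x, closure P x -> T x = 0.
Proof.
move=> /bounded_operator_continuous Tc PT x.
apply: (@closure_preimage _ _ T P [set 0] Tc); last exact: PT.
exact: accessible_closed_set1 (hausdorff_accessible _) _.
Qed.

(** * Closed subalgebras with commuting multiplication operators *)

Section AssociativeSubalgebra.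
Context {R : realType} {V : jbAlgebraType R}.
Implicit Types a b c d x y z : V.

(** In the linearized identity the argument [y] and the element [d] trade places. The operator of a
    triple product thus becomes a polynomial in the operators of its factors and of their pairwise
    products. *)
Lemma jmul3 a c d y : ((c *J a) *J d) *J y =
  (c *J d) *J (a *J y) + (a *J d) *J (c *J y) + (c *J a) *J (d *J y)
  - c *J (d *J (a *J y)) - a *J (d *J (c *J y)).
Proof.
have := jordan_linearized a y c d.
rewrite (jmulC (a *J y) (c *J d)) (jmulC (a *J y) d) (jmulC y c).
rewrite (jmulC (c *J y) (a *J d)) (jmulC (c *J y) d) (jmulC y d).
rewrite (jmulC y (_ *J d)) => eq0.
by apply/eqP; rewrite -subr_eq0 -oppr_eq0 -eq0; apply/eqP; module_ring.
Qed.

Inductive jpoly x : set V :=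
| jpoly1 : jpoly x jone
| jpolyZD k y z : jpoly x y -> jpoly x z -> jpoly x (k *: y + z)
| jpolyX y : jpoly x y -> jpoly x (x *J y).

(** By [jmul3], multiplication by [x (x u)] is a polynomial in the operators of [x], [x^2], [u] and
    [x u]. The induction therefore carries commutation with [u] and with [x u] together. *)
Lemma jpoly_comm x y (T : V -> V) : linear T ->
  (forall z, T (x *J z) = x *J T z) ->
  (forall z, T ((x *J x) *J z) = (x *J x) *J T z) ->
  jpoly x y -> forall z, T (y *J z) = y *J T z.
Proof.
move=> Tlin Tx Txx Py.
have TD u v : T (u + v) = T u + T v by have := Tlin 1 u v; rewrite !scale1r.
have T0 : T 0 = 0 by apply: (addIr (T 0)); rewrite -TD !add0r.
have TZ k u : T (k *: u) = k *: T u.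
  by have := Tlin k u 0; rewrite T0 !addr0.
have TN u : T (- u) = - T u by rewrite -scaleN1r TZ scaleN1r.
suff : (forall z, T (y *J z) = y *J T z) /\
       (forall z, T ((x *J y) *J z) = (x *J y) *J T z) by case.
elim: Py => [|k u v _ [Tu Txu] _ [Tv Txv]|u _ [Tu Txu]].
- by split=> z; rewrite ?jmulr1 // !jmul1.
- by split=> z; rewrite !jmulE TD TZ ?(Tu, Tv, Txu, Txv).
- split=> // z; rewrite (jmulC x (x *J u)) !(jmul3 u x x) (jmulC u x).
  by rewrite !(TD, TN) !(Tx, Txx, Tu, Txu).
Qed.

Lemma jpoly_mul_comm x y z w : jpoly x y -> jpoly x z ->
  y *J (z *J w) = z *J (y *J w).
Proof.
have Ll u : linear (jmul u) by exact: jmul_bilinear.2.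
move=> Py Pz; apply: (@jpoly_comm x z (jmul y)) => // {z Pz w} w; apply/esym.
- by apply: (@jpoly_comm x y (jmul x)) => // z; rewrite jmul_jordan.
- by apply: (@jpoly_comm x y (jmul (x *J x))) => // z; rewrite jmul_jordan.
Qed.

Lemma jpolyM x y z : jpoly x y -> jpoly x z -> jpoly x (y *J z).
Proof.
move=> Py Pz; elim: Pz => [|k u v _ Pu _ Pv|u Pu Pyu].
- by rewrite jmulr1.
- by rewrite jmulDr jmulZr; apply: jpolyZD.
- have Px : jpoly x x by rewrite -{2}(jmulr1 x); apply/jpolyX/jpoly1.
  by rewrite (jpoly_mul_comm _ Py Px); apply: jpolyX.
Qed.

(** Associativity is not a field: it follows from [jcar_comm] and commutativity ([jcarA]). The
    operators commute on all of [V], not only on the subalgebra. *)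
Record jassoc := JAssoc {
  jcar :> V -> Prop;
  jcar_closed : closed (jcar : set V);
  jcar1 : jcar jone;
  jcarZD : forall k y z, jcar y -> jcar z -> jcar (k *: y + z);
  jcarM : forall y z, jcar y -> jcar z -> jcar (y *J z);
  jcar_comm : forall y z w, jcar y -> jcar z ->
    y *J (z *J w) = z *J (y *J w) }.

Lemma scale_bounded (k : R) : bounded_operator (fun y : V => k *: y).
Proof.
split; first by move=> h y z; rewrite scalerDr !scalerA mulrC.
by exists `|k| => y; rewrite normrZ.
Qed.

Lemma jL2_bounded a b c :
  bounded_operator (fun z : V => a *J (b *J z) - c *J z).
Proof.
split; first by move=> k u v; rewrite !jmulE; module_ring.
exists (`|a| * `|b| + `|c|) => z; rewrite mulrDl.
rewrite (le_trans (ler_normB _ _))// lerD ?jnormM// -mulrA.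
by rewrite (le_trans (jnormM _ _))// ler_wpM2l// jnormM.
Qed.

Lemma jassoc_exists x : exists A : jassoc, A x.
Proof.
pose A := closure (jpoly x).
have Ac : closed A by apply: closed_closure.
have PA y : jpoly x y -> A y by apply: subset_closure.
have AZD k y z : A y -> A z -> A (k *: y + z).
  have addc (u : V) : continuous (fun v : V => v + u).
    by move=> v; apply: cvgD; [exact: cvg_id|exact: cvg_cst].
  move=> Ay; apply: (closure_preimage (f := fun v => k *: y + v)) => //.
    by move=> v; apply: cvgD; [exact: cvg_cst|exact: cvg_id].
  move=> {}z Pz; move: y Ay.
  apply: (closure_preimage (f := fun v : V => k *: v + z)) => //.
    move=> v; apply: cvgD; last exact: cvg_cst.
    exact: bounded_operator_continuous (scale_bounded k) v.
  by move=> y Py; apply/PA/jpolyZD.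
have jc (u : V) : continuous (jmul u).
  exact: bounded_operator_continuous (jL_bounded u).
have AM y z : A y -> A z -> A (y *J z).
  move=> Ay; apply: (closure_preimage (f := jmul y)) => // {}z Pz.
  rewrite jmulC; apply: (closure_preimage (f := jmul z)) Ay => // {}y Py.
  exact/PA/jpolyM.
have Acomm y z w : A y -> A z -> y *J (z *J w) = z *J (y *J w).
  move=> Ay Az; apply/eqP; rewrite -subr_eq0; apply/eqP.
  (* At a fixed [w] the commutator is a bounded operator in [z], then in [y]. Its kernel is closed,
     so each variable in turn reduces to a polynomial. *)
  rewrite (jmulC z w) (jmulC z (y *J w)).
  apply: (closure_eq0 (jL2_bounded y w (y *J w))) Az => {}z Pz /=.
  have : z *J (w *J y) - (w *J z) *J y = 0.
    apply: (closure_eq0 (jL2_bounded z w (w *J z))) Ay => {}y Py /=.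
    rewrite (jmulC w) (jpoly_mul_comm _ Pz Py) (jmulC w) (jmulC _ y).
    by rewrite subrr.
  rewrite (jmulC z) (jmulC w y) (jmulC _ y) -opprB => /eqP.
  by rewrite oppr_eq0 => /eqP.
exists (JAssoc Ac (PA _ (jpoly1 x)) AZD AM Acomm).
by have /PA := jpolyX (jpoly1 x); rewrite jmulr1.
Qed.
End AssociativeSubalgebra.

(** * The subalgebra as a commutative ring, and multiplicativity of U *)

Section SubalgebraRing.
Context {R : realType} {V : jbAlgebraType R} (A : @jassoc R V).
Implicit Types a b c d x y z : V.

Lemma jcar0 : A 0.
Proof. by have := jcarZD (-1) (jcar1 A) (jcar1 A); rewrite scaleN1r addNr. Qed.

Lemma jcarZ k x : A x -> A (k *: x).
Proof. by move=> Ax; rewrite -(addr0 (k *: x)); apply: jcarZD jcar0. Qed.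

Lemma jcarD x y : A x -> A y -> A (x + y).
Proof. by rewrite -{2}(scale1r x); apply: jcarZD. Qed.

Lemma jcarN x : A x -> A (- x).
Proof. by rewrite -scaleN1r; apply: jcarZ. Qed.

Lemma jcarA x y z : A x -> A y -> A z -> x *J (y *J z) = (x *J y) *J z.
Proof.
by move=> Ax Ay Az; rewrite (jmulC y) (jcar_comm y Ax Az) jmulC.
Qed.

(** As a type, [A] can carry a commutative ring structure, so that [ring] decides identities in it;
    [jscalar] turns real multiples into ring products. *)
Definition jsub : Type := {x : V | `[< A x >]}.

HB.instance Definition _ := Choice.on jsub.

Definition jsub_of x (Ax : A x) : jsub := exist _ x (asboolT Ax).

Lemma jsubP (u : jsub) : A (val u).
Proof. by case: u => x /= /asboolP. Qed.

Definition jsub_zero := jsub_of jcar0.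
Definition jsub_one := jsub_of (jcar1 A).
Definition jsub_add (u v : jsub) := jsub_of (jcarD (jsubP u) (jsubP v)).
Definition jsub_opp (u : jsub) := jsub_of (jcarN (jsubP u)).
Definition jsub_mul (u v : jsub) := jsub_of (jcarM (jsubP u) (jsubP v)).

Lemma jsub_addA : associative jsub_add.
Proof. by move=> u v w; apply: val_inj; rewrite /= addrA. Qed.

Lemma jsub_addC : commutative jsub_add.
Proof. by move=> u v; apply: val_inj; rewrite /= addrC. Qed.

Lemma jsub_add0 : left_id jsub_zero jsub_add.
Proof. by move=> u; apply: val_inj; rewrite /= add0r. Qed.

Lemma jsub_addN : left_inverse jsub_zero jsub_opp jsub_add.
Proof. by move=> u; apply: val_inj; rewrite /= addNr. Qed.

HB.instance Definition _ :=
  GRing.isZmodule.Build jsub jsub_addA jsub_addC jsub_add0 jsub_addN.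

Lemma jsub_mulA : associative jsub_mul.
Proof. by move=> u v w; apply: val_inj; apply: jcarA; apply: jsubP. Qed.

Lemma jsub_mulC : commutative jsub_mul.
Proof. by move=> u v; apply: val_inj; rewrite /= jmulC. Qed.

Lemma jsub_mul1 : left_id jsub_one jsub_mul.
Proof. by move=> u; apply: val_inj; rewrite /= jmul1. Qed.

Lemma jsub_mulDl : left_distributive jsub_mul +%R.
Proof. by move=> u v w; apply: val_inj; rewrite /= jmulDl. Qed.

HB.instance Definition _ := GRing.Zmodule_isComPzRing.Build jsub
  jsub_mulA jsub_mulC jsub_mul1 jsub_mulDl.

Definition jscalar (k : R) : jsub := jsub_of (jcarZ k (jcar1 A)).

Lemma jscalar_is_zmod_morphism : zmod_morphism jscalar.
Proof. by move=> k l; apply: val_inj; rewrite /= scalerBl. Qed.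

Lemma jscalar_is_monoid_morphism : monoid_morphism jscalar.
Proof.
split; first by apply: val_inj; rewrite /= scale1r.
by move=> k l; apply: val_inj; rewrite /= !jmulE scalerA.
Qed.

HB.instance Definition _ := GRing.isZmodMorphism.Build R jsub jscalar
  jscalar_is_zmod_morphism.
HB.instance Definition _ := GRing.isMonoidMorphism.Build R jsub jscalar
  jscalar_is_monoid_morphism.

Lemma jsub_val1 : val (1 : jsub) = jone. Proof. by []. Qed.
Lemma jsub_valD (u v : jsub) : val (u + v) = val u + val v. Proof. by []. Qed.
Lemma jsub_valN (u : jsub) : val (- u) = - val u. Proof. by []. Qed.
Lemma jsub_valM (u v : jsub) : val (u * v) = val u *J val v.
Proof. by []. Qed.
Lemma jsub_valZ k : val (jscalar k) = k *: jone. Proof. by []. Qed.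
Lemma jsub_valZM k (u : jsub) : val (jscalar k * u) = k *: val u.
Proof. by rewrite jsub_valM jmulZl jmul1. Qed.

Lemma jcar_mul3 a b c y : A a -> A b -> A c -> ((a *J b) *J c) *J y =
  (a *J b) *J (c *J y) + (b *J c) *J (a *J y) + (a *J c) *J (b *J y)
  - 2 *: (a *J (b *J (c *J y))).
Proof.
move=> Aa Ab Ac; rewrite (jmul3 b a c y).
rewrite (jcar_comm y Ac Ab) (jcar_comm y Ac Aa) (jcar_comm _ Ab Aa).
by module_ring.
Qed.

Lemma jU_M a b y : A a -> A b -> jU (a *J b) y = jU a (jU b y).
Proof.
move=> Aa Ab; have Aab := jcarM Aa Ab.
have Aaa := jcarM Aa Aa; have Abb := jcarM Ab Ab.
have Laab z := jcar_mul3 z Aa Aa Ab; have Labb z := jcar_mul3 z Aa Ab Ab.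
have E : (a *J b) *J (a *J b) = ((a *J a) *J b) *J b.
  by rewrite (jcarA Aab Aa Ab) (jmulC _ a) (jcarA Aa Aa Ab).
have := jcar_mul3 y Aab Aa Ab; have := jcar_mul3 y Aaa Ab Ab.
rewrite -(jcarA Aab Aa Ab) E => ->; rewrite (jmulC (a *J b) a) (jcarA Aa Aa Ab).
rewrite !(Laab, Labb) !(jcar_comm _ Ab Aa) => eq12.
(* The two ways of expanding L_{a^2 b^2} differ by the discriminant relation
   (L_{ab} - L_a L_b)^2 = (L_{a^2} - L_a^2) (L_{b^2} - L_b^2). *)
rewrite /jU /jL E !jmulE (jcar_mul3 y Aaa Ab Ab) !(Laab, Labb).
rewrite !(jcar_comm _ Aa Abb) (jcar_comm _ Aaa Abb).
apply/eqP; rewrite -subr_eq0 -(scaler0 _ 2); apply/eqP.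
move/eqP: eq12; rewrite eq_sym -subr_eq0 => /eqP <-.
module_ring.
Qed.
End SubalgebraRing.

(** * Affine contractions and majorized sequences *)

Section FixedPoints.
Context {R : realType} {X : completeNormedModType R}.

Lemma linear_fixed_point (C : set X) (T : X -> X) (k : R) (b : X) :
  closed C -> C !=set0 -> (forall y, C y -> C (b + T y)) ->
  linear T -> k < 1 -> (forall y, `|T y| <= k * `|y|) ->
  exists2 p, C p & p = b + T p.
Proof.
move=> Cc C0 CT Tlin k1 Tk.
(* The bound [k] may be negative, while a contraction ratio is nonnegative. *)
have k_ge0 : 0 <= Num.max k 0 by rewrite le_max lexx orbT.
have fC : set_fun C C (fun y => b + T y) by [].
pose f : {fun C >-> C} := HB.pack (fun y => b + T y) (isFun.Build _ _ C C _ fC).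
apply: (@banach_fixed_point _ _ _ f) => //; exists (NngNum k_ge0); split => /=.
  by rewrite gt_max k1 ltr01.
move=> [y z] /= [Cy Cz]; rewrite opprD addrACA subrr add0r.
have -> : T y - T z = T (y - z).
  by have /= := Tlin (-1) z y; rewrite !scaleN1r ![- _ + _]addrC => ->.
by rewrite (le_trans (Tk _))// ler_wpM2r// le_max lexx.
Qed.

(** The increments of [z] are dominated by those of [t], a bounded nondecreasing sequence, so the
    telescoped series of [z] converges absolutely. *)
Lemma cvg_majorized (z : nat -> X) (t : nat -> R) :
  (forall n, `|z n.+1 - z n| <= t n.+1 - t n) -> has_ubound (range t) ->
  cvgn z.
Proof.
move=> zt tub.
have tnd : nondecreasing_seq t.
  by apply/nondecreasing_seqP => n; rewrite -subr_ge0 (le_trans _ (zt n)).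
have tc : cvgn t by exact: nondecreasing_is_cvgn.
have -> : z = fun n => z 0%N + series (telescope z) n.
  by apply/funext => n; rewrite -eq_sum_telescope.
apply: is_cvgD; first exact: is_cvg_cst.
apply: normed_cvg; apply: (@series_le_cvg _ _ (telescope t)) => //= [n|].
- by rewrite (le_trans _ (zt n)).
- by rewrite telescopeK; apply: is_cvgB => //; exact: is_cvg_cst.
Qed.

End FixedPoints.

(** * Inverses and square roots in the subalgebra *)

Section SubalgebraAnalysis.
Context {R : realType} {V : jbAlgebraType R}.

(** The norm of the unit equals its own square. It is 0 in the zero algebra, hence an inequality. *)
Lemma norm_jone_le1 : `|jone : V| <= 1.
Proof.
have := jnorm_sqr (jone : V); rewrite jmul1 => N1.
rewrite leNgt; apply/negP => N_gt1.
have : `|jone : V| < `|jone : V| ^+ 2.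
  by rewrite expr2 ltr_pMr // (lt_trans ltr01).
by rewrite -N1 ltxx.
Qed.

Lemma norm_jU (a y : V) : `|jU a y| <= 3 * `|a| ^+ 2 * `|y|.
Proof.
have H : `|a *J (a *J y)| <= `|a| ^+ 2 * `|y|.
  by rewrite (le_trans (jnormM _ _))// expr2 -mulrA ler_wpM2l// jnormM.
rewrite (le_trans (ler_normB _ _))// normrZ ger0_norm //.
have -> : 3 * `|a| ^+ 2 * `|y| = 2 * (`|a| ^+ 2 * `|y|) + `|a| ^+ 2 * `|y|.
  by ring.
rewrite lerD ?ler_wpM2l//.
by rewrite (le_trans (jnormM _ _))// jnorm_sqr.
Qed.

Context (A : @jassoc R V).
Implicit Types u v w s c : jsub A.
Implicit Types k e N : R.

Local Notation "k %:J" := (jscalar A k) (at level 2, format "k %:J").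

Lemma jsub_norm_scalar k : `|val (k%:J)| <= `|k|.
Proof. by rewrite jsub_valZ normrZ ler_piMr// norm_jone_le1. Qed.

Lemma jsub_normZ k u : `|val (k%:J * u)| = `|k| * `|val u|.
Proof. by rewrite jsub_valZM normrZ. Qed.

Lemma jsub_normM u v : `|val (u * v)| <= `|val u| * `|val v|.
Proof. exact: jnormM. Qed.

Lemma jsub_norm_sqr u : `|val (u ^+ 2)| = `|val u| ^+ 2.
Proof. exact: jnorm_sqr. Qed.

Lemma jsub_norm_sqrD u v : `|val (u ^+ 2)| <= `|val (u ^+ 2 + v ^+ 2)|.
Proof. exact: jnorm_sqrD. Qed.

(** The inverse is the fixed point of the contraction [c |-> 1 + u c], which preserves the closed
    set [A]; the norm bound is read off the fixed-point equation. *)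
Lemma jsub_neumann u : `|val u| < 1 ->
  exists c, (1 - u) * c = 1 /\ (1 - `|val u|) * `|val c| <= 1.
Proof.
move=> u1.
have [||||c Ac cE] := @linear_fixed_point R V (jcar A : set V)
    (jmul (val u)) `|val u| jone (@jcar_closed _ _ A) _ _ _ u1 _.
- by exists jone; exact: jcar1.
- by move=> y Ay; apply: jcarD; [exact: jcar1|apply: jcarM => //; exact: jsubP].
- exact: (jmul_bilinear.2 _).
- by move=> y; exact: jnormM.
pose c' : jsub A := jsub_of Ac.
have c'E : c' = 1 + u * c' by apply: val_inj.
exists c'; split; first by rewrite mulrBl mul1r {1}c'E addrK.
rewrite mulrBl mul1r lerBlDr {1}c'E (le_trans (ler_normD _ _))// lerD//.
  exact: norm_jone_le1.
exact: jsub_normM.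
Qed.

(* Iterating z |-> (w + z^2) / 2 from 0 gives z with 1 - w = (1 - z)^2; the
   same scalar iteration with w = 1 majorizes it. *)
Lemma jsub_sqrt1 w : `|val w| <= 1 ->
  exists s, s ^+ 2 = 1 - w /\ `|val (1 - s)| <= 1.
Proof.
move=> w1.
have [z [z0 zS]] : exists z : nat -> V,
    z 0%N = 0 /\ forall n, z n.+1 = 2^-1 *: (val w + z n *J z n).
  by exists (fix z n := if n is m.+1 then 2^-1 *: (val w + z m *J z m) else 0).
have [t [t0 tS]] : exists t : nat -> R,
    t 0%N = 0 /\ forall n, t n.+1 = 2^-1 * (1 + t n ^+ 2).
  by exists (fix t n := if n is m.+1 then 2^-1 * (1 + t m ^+ 2) else 0).
have t01 n : 0 <= t n <= 1.
  by elim: n => [|n IH]; rewrite ?t0 ?lexx ?ler01// tS; nra.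
have zt n : `|z n| <= t n.
  elim: n => [|n IH]; first by rewrite z0 t0 normr0.
  rewrite zS tS normrZ ger0_norm ?invr_ge0// ler_wpM2l ?invr_ge0//.
  rewrite (le_trans (ler_normD _ _))// lerD// jnorm_sqr.
  by rewrite lerXn2r ?nnegrE ?(le_trans _ IH).
have zdt n : `|z n.+1 - z n| <= t n.+1 - t n.
  elim: n => [|n IH].
    by rewrite zS tS z0 t0 jmulr0 expr0n/= !addr0 !subr0 normrZ ger0_norm
      ?invr_ge0// ler_wpM2l ?invr_ge0.
  have -> : z n.+2 - z n.+1 = 2^-1 *: ((z n.+1 - z n) *J (z n.+1 + z n)).
    move: (zS n.+1) (zS n); set p := z n.+1; set q := z n => -> pE.
    rewrite [X in _ - X]pE !jmulE.
    by rewrite (jmulC q p); module_ring.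
  have -> : t n.+2 - t n.+1 = 2^-1 * ((t n.+1 - t n) * (t n.+1 + t n)).
    move: (tS n.+1) (tS n); set p := t n.+1; set q := t n => -> pE.
    by rewrite [X in _ - X]pE; ring.
  rewrite normrZ ger0_norm ?invr_ge0// ler_wpM2l ?invr_ge0//.
  rewrite (le_trans (jnormM _ _))// ler_pM//.
  by rewrite (le_trans (ler_normD _ _))// lerD.
have zc : cvgn z.
  apply: cvg_majorized zdt _; exists 1 => _ [n _ <-].
  by have /andP[] := t01 n.
have zA n : A (z n).
  elim: n => [|n IH]; first by rewrite z0; exact: jcar0.
  by rewrite zS; apply/jcarZ/jcarD/jcarM => //; exact: jsubP.
have Al : A (limn z).
  by apply: closed_cvg zc => //; [exact: jcar_closed|exact: nearW].
have l1 : `|limn z| <= 1.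
  have c1 : closed [set y : V | `|y| <= 1].
    have /continuous_closedP cn := @norm_continuous R V.
    exact: cn (@closed_le R 1).
  apply: (closed_cvg (fun y : V => `|y| <= 1)) zc => //; apply: nearW => n /=.
  by rewrite (le_trans (zt n))//; have /andP[] := t01 n.
have lE : limn z = 2^-1 *: (val w + limn z *J limn z).
  (* Expanding around the limit [l], [z^2 = (z - l)^2 + (2 l z - l^2)]: the first term tends to 0 in
     norm and the second is affine in [z]. *)
  have zz : z n *J z n @[n --> \oo] --> limn z *J limn z.
    have -> : (fun n => z n *J z n) = (fun n =>
        (z n - limn z) *J (z n - limn z) + (2 *: limn z *J z n -
          limn z *J limn z)).
      by apply/funext => n; rewrite !jmulE (jmulC _ (limn z)); module_ring.
    rewrite -[X in _ --> X]add0r; apply: cvgD.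
      apply/norm_cvg0P.
      have -> : (fun n => `|(z n - limn z) *J (z n - limn z)|) =
        (fun n => `|z n - limn z| * `|z n - limn z|).
        by apply/funext => n; rewrite jnorm_sqr expr2.
      have z0' : `|z n - limn z| @[n --> \oo] --> 0.
        by apply/norm_cvg0P/subr_cvg0.
      by rewrite -[X in _ --> X](mulr0 0); apply: cvgM.
    rewrite [X in _ --> X](_ : _ = 2 *: limn z *J limn z - limn z *J limn z);
      last by rewrite !jmulE; module_ring.
    apply: cvgB; last exact: cvg_cst.
    have jc : {for limn z, continuous (jmul (2 *: limn z))}.
      by apply: bounded_operator_continuous; exact: jL_bounded.
    exact: (cvg_comp _ _ zc jc).
  have zc1 : z n.+1 @[n --> \oo] --> limn z by rewrite cvg_shiftS.
  have zc2 : z n.+1 @[n --> \oo] --> 2^-1 *: (val w + limn z *J limn z).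
    have -> : (fun n => z n.+1) = (fun n => 2^-1 *: (val w + z n *J z n)).
      exact/funext.
    have wzz : val w + z n *J z n @[n --> \oo] --> val w + limn z *J limn z.
      by apply: cvgD => //; exact: cvg_cst.
    have sc : {for val w + limn z *J limn z, continuous ( *:%R (2^-1 : R))}.
      by apply: bounded_operator_continuous; exact: scale_bounded.
    exact: (cvg_comp _ _ wzz sc).
  exact: (cvg_unique _ zc1 zc2).
move: (limn z) Al l1 lE => l Al l1 lE.
exists (1 - jsub_of Al); split; last by rewrite subKr.
have lE2 : 2 *: l = val w + l *J l.
  by rewrite {1}lE scalerA divff ?scale1r // pnatr_eq0.
apply: val_inj; rewrite /= !jmulE.
have -> : val w = 2 *: l - l *J l by rewrite lE2 addrK.
by module_ring.
Qed.

Lemma jsub_norm_eq0 u : `|val u| = 0 -> u = 0.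
Proof. by move=> /normr0_eq0 u0; apply: val_inj. Qed.

(* The root 1 - z found above is within distance 1 of 1, hence again a square. *)
Lemma jsub_sqrt b N : `|val (N%:J - b)| <= N -> exists s, (s ^+ 2) ^+ 2 = b.
Proof.
move=> bN; have N_ge0 : 0 <= N by exact: le_trans bN.
have [N0|N0] := eqVneq N 0.
  exists 0; apply/esym; apply/eqP; rewrite -subr_eq0; apply/eqP.
  have : `|val (N%:J - b)| = 0.
    by apply/le_anti; rewrite normr_ge0 andbT -[X in _ <= X]N0.
  move/jsub_norm_eq0; rewrite N0 rmorph0 sub0r => /eqP.
  by rewrite oppr_eq0 => /eqP ->; ring.
have N_gt0 : 0 < N by rewrite lt0r N0.
have [|u [uE u1]] := @jsub_sqrt1 ((N^-1)%:J * (N%:J - b)).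
  by rewrite jsub_normZ ger0_norm ?invr_ge0// ler_pdivrMl // mulr1.
have [s [sE _]] := @jsub_sqrt1 (1 - u) u1.
exists ((Num.sqrt (Num.sqrt N))%:J * s).
have -> : (((Num.sqrt (Num.sqrt N))%:J * s) ^+ 2) ^+ 2 =
  ((Num.sqrt (Num.sqrt N)) ^+ 2 ^+ 2)%:J * (s ^+ 2) ^+ 2.
  by rewrite !rmorphXn; ring.
rewrite !sqr_sqrtr ?sqrtr_ge0// sE subKr uE mulrBr mulr1 mulrA -rmorphM divff//.
by rewrite rmorph1 mul1r subKr.
Qed.

(** After scaling to norm 1, [1 - u^2] is a square [s^2], and the norm axiom on sums of squares
    bounds [s^2] by [s^2 + u^2 = 1]. With [jsub_sqrt] this gives every square a square root that is
    itself a square. *)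
Lemma jsub_sqr_bound u : `|val ((`|val u| ^+ 2)%:J - u ^+ 2)| <= `|val u| ^+ 2.
Proof.
set N := `|val u|.
have [N0|N0] := eqVneq N 0.
  by rewrite (jsub_norm_eq0 N0) N0 !expr0n rmorph0 subr0 normr0.
have N_ge0 : 0 <= N by exact: normr_ge0.
have [|s [sE _]] := @jsub_sqrt1 (((N^-1)%:J * u) ^+ 2).
  rewrite jsub_norm_sqr jsub_normZ ger0_norm ?invr_ge0//.
  by rewrite -/N mulVf// expr1n.
have := jsub_norm_sqrD s ((N^-1)%:J * u).
rewrite {2}sE subrK => /le_trans/(_ norm_jone_le1); rewrite sE => le1.
have -> : (N ^+ 2)%:J - u ^+ 2 = (N ^+ 2)%:J * (1 - ((N^-1)%:J * u) ^+ 2).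
  rewrite mulrBr mulr1 exprMn mulrA -rmorphXn -rmorphM -exprMn divff//.
  by rewrite expr1n rmorph1 mul1r.
by rewrite jsub_normZ ger0_norm ?ler_piMr// exprn_ge0.
Qed.

(** The bounds of [jsub_sqr_bound] for two squares add up to the hypothesis of [jsub_sqrt] for their
    sum. *)
Lemma jsub_sqrD u v : exists w, u ^+ 2 + v ^+ 2 = w ^+ 2.
Proof.
have [|s sE] := @jsub_sqrt (u ^+ 2 + v ^+ 2) (`|val u| ^+ 2 + `|val v| ^+ 2).
  rewrite rmorphD opprD addrACA.
  by rewrite (le_trans (ler_normD _ _))// lerD// jsub_sqr_bound.
by exists (s ^+ 2).
Qed.

(** With [N = |u|^2], [u^2 + e = (N + e) (1 - w)] where [|w| <= N / (N + e) < 1]; the Neumann bound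
    on the inverse of [1 - w] gives the estimate on [c]. *)
Lemma jsub_sqrD_inv u e : 0 < e ->
  exists c, (u ^+ 2 + e%:J) * c = 1 /\ e * `|val c| <= 1.
Proof.
move=> e0; set N := `|val u| ^+ 2; have N_ge0 : 0 <= N by exact: exprn_ge0.
have Ne : 0 < N + e by exact: ltr_wpDl.
set w := ((N + e)^-1)%:J * (N%:J - u ^+ 2).
have wN : `|val w| <= N / (N + e).
  rewrite jsub_normZ ger0_norm ?invr_ge0 ?(ltW Ne)// mulrC.
  by rewrite ler_wpM2r ?invr_ge0 ?(ltW Ne)// jsub_sqr_bound.
have w1 : `|val w| < 1.
  by rewrite (le_lt_trans wN)// ltr_pdivrMr// mul1r ltrDl.
have [c [cE cN]] := jsub_neumann w1.
exists (((N + e)^-1)%:J * c); split.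
  rewrite -cE mulrA; congr (_ * _).
  have -> : u ^+ 2 + e%:J = (N + e)%:J - (N%:J - u ^+ 2).
    by rewrite rmorphD; ring.
  by rewrite mulrBl -rmorphM divff ?gt_eqF// rmorph1 [_ * _%:J]mulrC.
rewrite jsub_normZ ger0_norm ?invr_ge0 ?(ltW Ne)// mulrA.
apply: le_trans cN; rewrite ler_wpM2r//.
rewrite lerBrDr (le_trans (lerD (lexx _) wN))// -mulrDl addrC divff//.
by rewrite gt_eqF.
Qed.

End SubalgebraAnalysis.

(** * Invertibility, positivity and the spectral radius *)

Section Invertibility.
Context {R : realType} {V : jbAlgebraType R} (A : @jassoc R V).
Implicit Types u v w s c : jsub A.
Implicit Types k e N t : R.

Local Notation "k %:J" := (jscalar A k) (at level 2, format "k %:J").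

Lemma jU_subE u v : jU (val u) (val v) = val (u ^+ 2 * v).
Proof.
have -> : u ^+ 2 * v = 2%:J * (u * (u * v)) - u * u * v.
  by rewrite rmorph_nat; ring.
by rewrite jsub_valD jsub_valZM.
Qed.

Lemma jU_sub1 u : jU (val u) jone = val (u ^+ 2).
Proof. by rewrite -(jsub_val1 A) jU_subE mulr1. Qed.

Lemma jU_subM u v y : jU (val (u * v)) y = jU (val u) (jU (val v) y).
Proof. exact: jU_M (jsubP u) (jsubP v). Qed.

Lemma jU_jone y : jU (jone : V) y = y.
Proof. by rewrite /jU /jL !jmul1; module_ring. Qed.

(* With c_e the inverse of x^2 + e, the bound |c_e|^2 = |U_{c_e x} y| <=
   6 |c_e| |y| keeps c_e bounded, so that x^2 c_e = 1 - e c_e is invertible for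
   small e. *)
Lemma jsub_inv_of_jU u (y : V) : jU (val u) y = jone -> exists c, u * c = 1.
Proof.
(* The 6 is the constant 3 of [norm_jU] times the bound 2 on the norm of [1 - M^-1 c]; adding 1
   makes [M^-1 c] of norm less than 1. *)
move=> Uy; set M := 6 * `|y| + 1.
have M_gt0 : 0 < M by rewrite ltr_wpDl // mulr_ge0.
have e_gt0 : 0 < M^-1 by rewrite invr_gt0.
have [c [cE cM]] := jsub_sqrD_inv u e_gt0.
have u2c : u ^+ 2 * c = 1 - M^-1%:J * c by rewrite -cE mulrDl addrK.
have c6 : `|val c| <= 6 * `|y|.
  have [c0|c0] := eqVneq `|val c| 0; first by rewrite c0 mulr_ge0.
  have c_gt0 : 0 < `|val c| by rewrite lt0r c0 normr_ge0.
  have cu : `|val (c * u)| ^+ 2 <= 2 * `|val c|.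
    rewrite -jsub_norm_sqr.
    have -> : (c * u) ^+ 2 = (u ^+ 2 * c) * c by ring.
    rewrite u2c (le_trans (jsub_normM _ _)) // ler_wpM2r //.
    rewrite (le_trans (ler_normB _ _))// -natr1 addrC lerD ?norm_jone_le1//.
    by rewrite jsub_normZ ger0_norm // ltW.
  rewrite -(ler_pM2l c_gt0) -expr2 -jsub_norm_sqr -jU_sub1 -Uy -jU_subM.
  rewrite (le_trans (norm_jU _ _))//.
  have -> : `|val c| * (6 * `|y|) = 3 * (2 * `|val c|) * `|y| by ring.
  by rewrite ler_wpM2r// ler_wpM2l.
have c1 : `|val (M^-1%:J * c)| < 1.
  rewrite jsub_normZ ger0_norm ?(ltW e_gt0)// ltr_pdivrMl// mulr1.
  by rewrite (le_lt_trans c6)// ltrDl.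
have [d [dE _]] := jsub_neumann c1.
by exists (u * c * d); rewrite -dE -u2c; ring.
Qed.

Lemma jinvertible_sub u : jinvertible (val u) <-> exists c, u * c = 1.
Proof.
split=> [[y [_ Uy]]|[c uc]]; first exact: jsub_inv_of_jU Uy.
exists (val c); rewrite -(jsub_valM c c) !jU_subE -(jsub_val1 A).
by split; congr val;
  rewrite ?expr2 -?mulrA ?[u * (c * c)]mulrA uc ?mul1r ?mulr1.
Qed.

Lemma positive_cone_sub u :
  positive_cone (val u) <-> forall t, 0 <= t -> exists c, (u + t%:J) * c = 1.
Proof.
have shift t : val u - t *: jone = val (u + (- t)%:J).
  by rewrite jsub_valD jsub_valZ scaleNr.
split=> [pos t t0|inv t].
  apply/jinvertible_sub; apply: contrapT => ninv.
  have := pos (- t); rewrite /jspectrum /= shift opprK => /(_ ninv).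
  by rewrite in_itv/= andbT oppr_gt0 ltNge t0.
move=> ninv; rewrite /= in_itv/= andbT ltNge; apply/negP => t0; apply: ninv.
by rewrite shift; apply/jinvertible_sub/inv; rewrite oppr_ge0.
Qed.

(* Otherwise |u|^2 - u^2 - d would be a square for some d > 0, and the norm of
   u^2 would be at most |u|^2 - d. *)
Lemma jsub_norm_spectrum u c : 0 < `|val u| ->
  ((`|val u| ^+ 2)%:J - u ^+ 2) * c = 1 -> False.
Proof.
set N := `|val u| ^+ 2 => u_gt0 uc.
have N_gt0 : 0 < N by exact: exprn_gt0.
set g := N%:J - u ^+ 2 in uc.
have [|s sE] := @jsub_sqrt _ _ A g N.
  by rewrite subKr jsub_norm_sqr.
have M_gt0 : 0 < `|val c| + N^-1 by rewrite ltr_wpDl // invr_gt0.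
(* This [d] satisfies [d |c| <= 1], which makes [1 - d c] a square, and [d <= N], which keeps
   [N - d] nonnegative. *)
set d := (`|val c| + N^-1)^-1.
have d_gt0 : 0 < d by rewrite invr_gt0.
have dN : d <= N.
  by rewrite -[leRHS]invrK lef_pV2 ?posrE ?invr_gt0// lerDr.
have [|r rE] := @jsub_sqrt _ _ A (1 - d%:J * c) 1.
  rewrite rmorph1 subKr jsub_normZ ger0_norm ?(ltW d_gt0)//.
  by rewrite ler_pdivrMl // mulr1 lerDl invr_ge0 ltW.
have gd : u ^+ 2 + (s ^+ 2 * r ^+ 2) ^+ 2 = (N - d)%:J.
  have -> : (s ^+ 2 * r ^+ 2) ^+ 2 = (s ^+ 2) ^+ 2 * (r ^+ 2) ^+ 2 by ring.
  have -> : (s ^+ 2) ^+ 2 * (r ^+ 2) ^+ 2 = g - d%:J * (g * c).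
    by rewrite sE rE; ring.
  by rewrite uc /g rmorphB; ring.
have := jsub_norm_sqrD u (s ^+ 2 * r ^+ 2); rewrite gd jsub_norm_sqr -/N.
move=> /le_trans/(_ (jsub_norm_scalar _ _)).
by rewrite ger0_norm ?subr_ge0// leNgt ltrBlDr ltrDl d_gt0.
Qed.

(** If [N = |w|] were at least 1, then [(t + v) (N - w) = (N + 1) v + t (N - 1)] and
    [(t + v) (N + w) = (N - 1) v + t (N + 1)] would be invertible. So would [N^2 - w^2], against
    [jsub_norm_spectrum]. *)
Lemma cayley_transform v t : 0 < t ->
  (forall t, 0 <= t -> exists c, (v + t%:J) * c = 1) ->
  exists d w, [/\ (t%:J + v) * d = 1, t%:J - v = (t%:J + v) * w
    & `|val w| < 1].
Proof.
move=> t_gt0 vinv; have [d dE] := vinv t (ltW t_gt0); rewrite addrC in dE.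
set w := (t%:J - v) * d; exists d, w; split=> //.
  by rewrite /w mulrCA dE mulr1.
rewrite ltNge; apply/negP; set N := `|val w| => N1.
have N_gt0 : 0 < N by exact: lt_le_trans N1.
have wE : w * (t%:J + v) = t%:J - v by rewrite /w -mulrA (mulrC d) dE mulr1.
(* The degenerate case [a = 0] arises when [N = 1]. *)
have lin_inv a b : 0 <= a -> 0 <= b -> 0 < a + b ->
    exists c, (a%:J * v + b%:J) * c = 1.
  move=> a0 b0 ab0; have [aE|a_neq0] := eqVneq a 0.
    exists (b^-1)%:J; rewrite aE rmorph0 mul0r add0r -rmorphM divff ?rmorph1//.
    by move: ab0; rewrite aE add0r => /gt_eqF ->.
  have [|c cE] := vinv (b / a); first by rewrite divr_ge0.
  exists ((a^-1)%:J * c); rewrite -cE.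
  have -> : b%:J = a%:J * (b / a)%:J by rewrite -rmorphM mulrCA divff ?mulr1.
  have aa : a%:J * a^-1%:J = 1 by rewrite -rmorphM divff ?rmorph1.
  transitivity (a%:J * a^-1%:J * ((v + (b / a)%:J) * c)); first by ring.
  by rewrite aa mul1r.
have N1_ge0 : 0 <= N + 1 by rewrite addr_ge0 // ltW.
have [c1 c1E] : exists c, (N%:J - w) * c = 1.
  have [||c cE] := lin_inv (N + 1) (t * (N - 1)) N1_ge0.
  - by rewrite mulr_ge0 ?subr_ge0// ltW.
  - by rewrite ltr_wpDr ?ltr_wpDl// ?mulr_ge0 ?subr_ge0// ltW.
  exists ((t%:J + v) * c); rewrite -cE mulrA mulrBl wE.
  by rewrite !(rmorphM, rmorphD, rmorphB) rmorph1; ring.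
have [c2 c2E] : exists c, (N%:J + w) * c = 1.
  have [|||c cE] := lin_inv (N - 1) (t * (N + 1)).
  - by rewrite subr_ge0.
  - by rewrite mulr_ge0 // ltW.
  - by rewrite ltr_wpDl ?subr_ge0// mulr_gt0// ltr_wpDl// ltW.
  exists ((t%:J + v) * c); rewrite -cE mulrA mulrDl wE.
  by rewrite !(rmorphM, rmorphD, rmorphB) rmorph1; ring.
apply: (@jsub_norm_spectrum w (c1 * c2)) => //.
rewrite -/N rmorphXn.
have -> : (N%:J ^+ 2 - w ^+ 2) * (c1 * c2) =
    (N%:J - w) * c1 * ((N%:J + w) * c2).
  by ring.
by rewrite c1E c2E mulr1.
Qed.

End Invertibility.

(** * Invertible bounded operators *)

Section InvertibleOperators.
Context {R : realType}.

Lemma bounded_operator_comp (V : normedModType R) (S T : V -> V) :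
  bounded_operator S -> bounded_operator T -> bounded_operator (S \o T).
Proof.
move=> [Sl [M SM]] [Tl [M' TM]]; split; first by move=> k x y; rewrite /= Tl Sl.
exists (`|M| * `|M'|) => y; rewrite /= (le_trans (SM _))// -mulrA.
rewrite (le_trans (ler_wpM2r _ (ler_norm M)))// ler_wpM2l//.
by rewrite (le_trans (TM _))// ler_wpM2r// ler_norm.
Qed.

Lemma invertible_operator_comp (V : normedModType R) (S T : V -> V) :
  invertible_operator S -> invertible_operator T ->
  invertible_operator (S \o T).
Proof.
move=> [Sb [S' [S'b S'S SS']]] [Tb [T' [T'b T'T TT']]].
split; [exact: bounded_operator_comp|].
exists (T' \o S'); split; first exact: bounded_operator_comp.
- by apply/funext => y; have := congr1 (fun f => T' (f (T y))) S'S => /= ->;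
    have := congr1 (fun f => f y) T'T.
- by apply/funext => y; have := congr1 (fun f => S (f (S' y))) TT' => /= ->;
    have := congr1 (fun f => f y) SS'.
Qed.

Lemma invertible_operator_factor (V : normedModType R) (S T : V -> V) :
  bounded_operator S -> bounded_operator T -> (forall y, S (T y) = T (S y)) ->
  invertible_operator (S \o T) -> invertible_operator T.
Proof.
move=> Sb Tb ST [_ [Q [Qb QST STQ]]].
have QK y : Q (S (T y)) = y by have := congr1 (fun f => f y) QST.
have KQ y : S (T (Q y)) = y by have := congr1 (fun f => f y) STQ.
split=> //; exists (Q \o S); split; first exact: bounded_operator_comp.
- by apply/funext => y; exact: QK.
- by apply/funext => y /=; rewrite -[T _]QK ST -ST ST KQ -ST QK.
Qed.

Lemma invertible_1subr (V : completeNormedModType R) (T : V -> V) (k : R) :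
  bounded_operator T -> k < 1 -> (forall y, `|T y| <= k * `|y|) ->
  invertible_operator (fun y => y - T y).
Proof.
move=> [Tl _] k1 Tk.
have Tb : bounded_operator (fun y => y - T y).
  split; first by move=> a x y; rewrite Tl; module_ring.
  exists (1 + k) => y; rewrite mulrDl mul1r (le_trans (ler_normB _ _))//.
  by rewrite lerD.
have Tge y : (1 - k) * `|y| <= `|y - T y|.
  rewrite mulrBl mul1r lerBlDr -{1}(subrK (T y) y).
  by rewrite (le_trans (ler_normD _ _))// lerD.
have Tinj x y : x - T x = y - T y -> x = y.
  move=> xy; apply/eqP; rewrite -subr_eq0 -normr_le0.
  rewrite -(pmulr_rle0 _ (_ : 0 < 1 - k)) ?subr_gt0//.
  rewrite (le_trans (Tge _))// normr_le0.
  have -> : T (x - y) = T x - T y.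
    by have /= := Tl (-1) y x; rewrite !scaleN1r ![- _ + _]addrC => ->.
  by rewrite opprD addrACA -opprD xy subrr.
have surj b : exists p, p - T p = b.
  have [||p _ pE] := @linear_fixed_point _ V setT T k b closedT _ _ Tl k1 Tk.
  - by exists 0.
  - by [].
  - by exists p; rewrite {1}pE addrK.
have [S SE] := choice surj.
split=> //; exists S; split.
- split=> [a x y|].
    by apply: Tinj; rewrite SE Tl opprD addrACA -scalerBr !SE.
  exists (1 - k)^-1 => y; rewrite -ler_pdivrMl ?invr_gt0 ?subr_gt0// invrK.
  by rewrite (le_trans (Tge _))// SE.
- by apply/funext => y /=; apply: Tinj; rewrite SE.
- by apply/funext => y /=; rewrite SE.
Qed.

Lemma expr_lt_eventually (r k : R) : 0 <= r < 1 -> 0 < k ->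
  exists n, r ^+ n < k.
Proof.
move=> /andP[r0 r1] k0.
have /cvgrPdist_lt /(_ _ k0) [n _ /(_ n (leqnn n))] : r ^+ n @[n --> \oo] --> 0.
  by apply: cvg_expr; rewrite ger0_norm.
by rewrite /= sub0r normrN ger0_norm ?exprn_ge0// => rn; exists n.
Qed.

End InvertibleOperators.

Section PositiveElements.
Context {R : realType} {V : jbAlgebraType R} (A : @jassoc R V).
Implicit Types u v w s c : jsub A.
Implicit Types k e N t : R.

Local Notation "k %:J" := (jscalar A k) (at level 2, format "k %:J").

Lemma jU_sub_invertible u c : u * c = 1 -> invertible_operator (jU (val u)).
Proof.
move=> uc; split; first exact: jU_bounded.
exists (jU (val c)); split; first exact: jU_bounded.
- by apply/funext => y; rewrite /comp -jU_subM mulrC uc jU_jone.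
- by apply/funext => y; rewrite /comp -jU_subM uc jU_jone.
Qed.

Lemma jU_N (x y : V) : jU x (- y) = - jU x y.
Proof. by rewrite /jU /jL !jmulE; module_ring. Qed.

Lemma jU_D (x y z : V) : jU x (y + z) = jU x y + jU x z.
Proof. by rewrite /jU /jL !jmulE; module_ring. Qed.

Lemma jU_1subr_1addr (x y : V) :
  y - jU x y + jU x (y - jU x y) = y - jU x (jU x y).
Proof. by rewrite (jU_D _ y (- _)) jU_N; module_ring. Qed.

Lemma jU_1addr_1subr (x y : V) :
  y + jU x y - jU x (y + jU x y) = y - jU x (jU x y).
Proof. by rewrite (jU_D _ y (jU x y)); module_ring. Qed.

Lemma bounded_1addU (x : V) : bounded_operator (fun y => y + jU x y).
Proof.
split; first by move=> k y z; rewrite (jU_bounded x).1; module_ring.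
exists (1 + 3 * `|x| ^+ 2) => y; rewrite mulrDl mul1r.
by rewrite (le_trans (ler_normD _ _))// lerD// norm_jU.
Qed.

Lemma bounded_1subU (x : V) : bounded_operator (fun y => y - jU x y).
Proof.
split; first by move=> k y z; rewrite (jU_bounded x).1; module_ring.
exists (1 + 3 * `|x| ^+ 2) => y; rewrite mulrDl mul1r.
by rewrite (le_trans (ler_normB _ _))// lerD// norm_jU.
Qed.

Lemma jU_1subr_factor w :
  (fun y => y - jU (val (w ^+ 2)) y) =
  (fun y => y + jU (val w) y) \o (fun y => y - jU (val w) y).
Proof.
apply/funext => y; rewrite /comp; cbv beta; rewrite expr2 jU_subM.
by rewrite jU_1subr_1addr.
Qed.

Lemma jU_1subr_invertible w : `|val w| < 1 ->
  invertible_operator (fun y => y - jU (val w) y).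
Proof.
move=> w1; have [n] : exists n, 3 * `|val w| ^+ n < 1.
  have [||n wn] := @expr_lt_eventually R `|val w| 3^-1.
  - by rewrite normr_ge0.
  - by rewrite invr_gt0.
  - by exists n; rewrite mulrC -ltr_pdivlMr// mul1r.
have : (n <= 2 ^ n)%N by rewrite ltnW // ltn_expl.
move=> /(ler_wiXn2l (normr_ge0 _) (ltW w1)) le2n.
move=> /(le_lt_trans (ler_wpM2l (ler0n _ 3) le2n)) {le2n}.
elim: n w w1 => [|n IH] w w1 w3.
  apply: (invertible_1subr (jU_bounded _) _ (norm_jU _)).
  apply: le_lt_trans w3; rewrite ler_wpM2l// expn0.
  by rewrite expr2 ler_piMr // ltW.
apply: (@invertible_operator_factor _ _ (fun y => y + jU (val w) y)).
- exact: bounded_1addU.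
- exact: bounded_1subU.
- by move=> y; rewrite jU_1subr_1addr jU_1addr_1subr.
rewrite -jU_1subr_factor; apply: IH; rewrite jsub_norm_sqr.
  by rewrite expr_lt1.
by rewrite -exprM -expnS.
Qed.

Lemma jU_1addr_invertible w : `|val w| < 1 ->
  invertible_operator (fun y => y + jU (val w) y).
Proof.
move=> w1; apply: (@invertible_operator_factor _ _ (fun y => y - jU (val w) y)).
- exact: bounded_1subU.
- exact: bounded_1addU.
- by move=> y; rewrite jU_1subr_1addr jU_1addr_1subr.
have -> : (fun y => y - jU (val w) y) \o (fun y => y + jU (val w) y) =
    (fun y => y - jU (val (w ^+ 2)) y).
  rewrite jU_1subr_factor; apply/funext => y; rewrite /comp; cbv beta.
  by rewrite jU_1subr_1addr jU_1addr_1subr.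
by apply: jU_1subr_invertible; rewrite jsub_norm_sqr expr_lt1.
Qed.

Lemma jU_scalarB_D t v y :
  jU (val (t%:J + v)) y + jU (val (t%:J - v)) y =
  2 *: (jU (val v) y + t ^+ 2 *: y).
Proof.
rewrite !(jsub_valD, jsub_valN) jsub_valZ /jU /jL !jmulE.
by module_ring.
Qed.

Lemma positive_jU_spectrum v : positive_cone (val v) ->
  operator_spectrum (jU (val v)) `<=` `]0, +oo[.
Proof.
move=> /positive_cone_sub vinv t; rewrite /= in_itv/= andbT ltNge => nt.
apply/negP => t0; apply: nt.
have [t_eq0|t_neq0] := eqVneq t 0.
  have [c cE] := vinv 0 (lexx _); rewrite rmorph0 addr0 in cE.
  have := jU_sub_invertible cE; congr invertible_operator.
  by apply/funext => y; rewrite t_eq0 scale0r subr0.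
have s_gt0 : 0 < Num.sqrt (- t) by rewrite sqrtr_gt0 oppr_gt0 lt_neqAle t_neq0.
have sE : Num.sqrt (- t) ^+ 2 = - t by rewrite sqr_sqrtr // oppr_ge0.
have [d [w [dE wE w1]]] := cayley_transform s_gt0 vinv.
have inv :=
  invertible_operator_comp (jU_sub_invertible dE) (jU_1addr_invertible w1).
have sb (k : R) : k != 0 -> invertible_operator ( *:%R k : V -> V).
  move=> k0; split; first exact: scale_bounded.
  exists ( *:%R k^-1); split; first exact: scale_bounded.
  - by apply/funext => y /=; rewrite scalerA mulVf// scale1r.
  - by apply/funext => y /=; rewrite scalerA divff// scale1r.
have := invertible_operator_comp (sb 2^-1 _) inv; rewrite invr_eq0 pnatr_eq0.
move=> /(_ isT); congr invertible_operator; apply/funext => y.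
rewrite /comp; cbv beta; rewrite jU_D -jU_subM -wE jU_scalarB_D sE.
by rewrite scalerA mulVf ?scale1r ?scaleNr.
Qed.

End PositiveElements.

Section CentralSymmetry.
Context {R : realType} {V : jbAlgebraType R}.

Lemma jU_mul_central_symmetry (v e y : V) : central_symmetry e ->
  jU (v *J e) y = jU v y.
Proof.
move=> [p [pc pp] ->].
have pM (x z : V) : p *J (x *J z) = x *J (p *J z).
  by have := congr1 (fun f => f z) (pc x).
have pA (x z : V) : (p *J x) *J z = p *J (x *J z).
  by rewrite jmulC -pM (jmulC z).
set e' := _ - _.
have eM (x z : V) : e' *J (x *J z) = x *J (e' *J z).
  by rewrite /e' !jmulE pM.
have eA (x z : V) : (x *J e') *J z = e' *J (x *J z).
  by rewrite (jmulC _ z) (jmulC x) -eM (jmulC z).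
have ee (x : V) : e' *J (e' *J x) = x.
  by rewrite /e' !jmulE -pA pp; module_ring.
have E : (v *J e') *J (v *J e') = v *J v by rewrite eA (jmulC v e') -eM ee.
by rewrite /jU /jL E !eA -eM ee.
Qed.

End CentralSymmetry.

(* When e^2 = 1, the kernel of L_e is the Peirce 1/2-space of (1 + e) / 2; there
   [jpeirce e a] acts as multiplication by the part of a below (1 + e) / 2. *)
Section HalfSpace.
Context {R : realType} {V : jbAlgebraType R} (A : @jassoc R V).
Implicit Types a b c s u v e : jsub A.
Implicit Types k t : R.
Implicit Types x y w : V.

Local Notation "k %:J" := (jscalar A k) (at level 2, format "k %:J").

Definition jpeirce e a y : V := val (a + e * a) *J y.

Lemma jpeirceD e a b y : jpeirce e (a + b) y = jpeirce e a y + jpeirce e b y.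
Proof. by rewrite /jpeirce -jmulDl -jsub_valD mulrDr addrACA. Qed.

Lemma jpeirceN e a y : jpeirce e (- a) y = - jpeirce e a y.
Proof. by rewrite /jpeirce mulrN -opprD jsub_valN jmulNl. Qed.

Lemma jpeirce0 e y : jpeirce e 0 y = 0.
Proof. by rewrite /jpeirce mulr0 addr0 jmul0r. Qed.

Lemma jpeirce0r e a : jpeirce e a 0 = 0.
Proof. by rewrite /jpeirce jmulr0. Qed.

Lemma jpeirceDr e a x y : jpeirce e a (x + y) = jpeirce e a x + jpeirce e a y.
Proof. exact: jmulDr. Qed.

Lemma jpeirceZr e a k y : jpeirce e a (k *: y) = k *: jpeirce e a y.
Proof. exact: jmulZr. Qed.

Lemma jpeirceC e e' a b y :
  jpeirce e a (jpeirce e' b y) = jpeirce e' b (jpeirce e a y).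
Proof. by apply: jcar_comm; exact: jsubP. Qed.

Context (e : jsub A) (ee : e ^+ 2 = 1).

Lemma jpeirce_ker a y : val e *J y = 0 -> val e *J jpeirce e a y = 0.
Proof.
move=> ey; rewrite /jpeirce (@jcar_comm _ _ A); try exact: jsubP.
by rewrite ey jmulr0.
Qed.

Lemma jpeirce_norm a y : `|jpeirce e a y| <= 2 * `|val a| * `|y|.
Proof.
have e1 : `|val e| <= 1.
  rewrite -(@ler_pXn2r _ 2)// ?nnegrE// expr1n -jsub_norm_sqr ee.
  exact: norm_jone_le1.
rewrite (le_trans (jnormM _ _))// ler_wpM2r// (le_trans (ler_normD _ _))//.
rewrite mulr_natl mulr2n lerD// (le_trans (jsub_normM _ _))//.
by rewrite ler_piMl.
Qed.

Lemma jmul_half a b y : val e *J y = 0 ->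
  val (a * b * e) *J y =
  val (b * e) *J (val a *J y) + val (a * e) *J (val b *J y).
Proof.
move=> ey; have := jcar_mul3 y (jsubP a) (jsubP b) (jsubP e).
by rewrite ey !jmulr0 scaler0 subr0 add0r.
Qed.

Lemma jpeirceM a b y : val e *J y = 0 ->
  jpeirce e a (jpeirce e b y) = jpeirce e (a * b) y.
Proof.
move=> ey; have E1 := jmul_half a b ey.
have E2 := jmul_half (a * e) b ey.
have {}E2 : val (a * b) *J y = val (b * e) *J (val (a * e) *J y)
    + val a *J (val b *J y).
  have <- : a * e * b * e = a * b by rewrite -[RHS]mulr1 -ee; ring.
  by rewrite E2; have -> : a * e * e = a by rewrite -mulrA -expr2 ee mulr1.
rewrite /jpeirce !jsub_valD !jmulDl !jmulDr.
have -> : e * (a * b) = a * b * e by ring.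
rewrite E1 E2 (mulrC e a) (mulrC e b).
rewrite (@jcar_comm _ _ A _ _ y (jsubP (a * e)) (jsubP (b * e))).
rewrite (@jcar_comm _ _ A _ _ y (jsubP a) (jsubP (b * e))).
by module_ring.
Qed.

Lemma jpeirce1 y : val e *J y = 0 -> jpeirce e 1 y = y.
Proof.
by move=> ey; rewrite /jpeirce mulr1 jsub_valD jmulDl ey addr0 jmul1.
Qed.

Lemma jpeirce_unit_inj a c y : val e *J y = 0 -> a * c = 1 ->
  jpeirce e a y = 0 -> y = 0.
Proof.
by move=> ey ac ay; rewrite -(jpeirce1 ey) -ac mulrC -jpeirceM // ay jpeirce0r.
Qed.

Lemma jpeirce_idealM a b y : val e *J y = 0 ->
  jpeirce e b y = 0 -> jpeirce e (a * b) y = 0.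
Proof. by move=> ey by0; rewrite -jpeirceM // by0 jpeirce0r. Qed.

Lemma jpeirce_scalar k y : val e *J y = 0 -> jpeirce e k%:J y = k *: y.
Proof.
move=> ey; rewrite -{2}(jpeirce1 ey) /jpeirce mulr1.
have -> : k%:J + e * k%:J = k%:J * (1 + e) by ring.
by rewrite jsub_valZM jmulZl.
Qed.

(* Here si^2 is the modulus of v - ci. If s0^2 + (c0 - v) and s1^2 - (c1 - v)
   kill a vector w, so does the left-hand side: v lies between c0 and c1 on w. *)
Lemma jsub_window v s0 s1 (c0 c1 : R) : c0 < c1 ->
  (s0 ^+ 2) ^+ 2 = (c0%:J - v) ^+ 2 -> (s1 ^+ 2) ^+ 2 = (c1%:J - v) ^+ 2 ->
  exists g : jsub A, `|val g| <= 1 /\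
   2%:J * v - (c0 + c1)%:J - (c1 - c0)%:J * g =
   g * ((s0 ^+ 2 + (c0%:J - v)) + (s1 ^+ 2 - (c1%:J - v)))
   - (s0 ^+ 2 + (c0%:J - v)) + (s1 ^+ 2 - (c1%:J - v)).
Proof.
move=> c01 s0E s1E; set k := s0 ^+ 2 + s1 ^+ 2.
have [r rE] := jsub_sqrD ((c0 + c1)%:J - 2%:J * v) (2%:J * s0 * s1).
have [|c [cE _]] := @jsub_sqrD_inv _ _ A r ((c1 - c0) ^+ 2).
  by rewrite exprn_gt0 // subr_gt0.
have k2 : 2%:J * k ^+ 2 = r ^+ 2 + ((c1 - c0) ^+ 2)%:J.
  have -> : k ^+ 2 = (s0 ^+ 2) ^+ 2 + (s1 ^+ 2) ^+ 2 + 2%:J * (s0 * s1) ^+ 2.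
    by rewrite /k rmorph_nat; ring.
  by rewrite s0E s1E -rE rmorph_nat; ring.
have kc : k * (2%:J * k * c) = 1 by rewrite -cE -k2; ring.
set k' := 2%:J * k * c in kc.
exists ((s0 ^+ 2 - s1 ^+ 2) * k'); split.
  rewrite -(@ler_pXn2r _ 2)// ?nnegrE// expr1n -jsub_norm_sqr.
  rewrite (le_trans (jsub_norm_sqrD _ (2%:J * s0 * s1 * k')))//.
  have -> : ((s0 ^+ 2 - s1 ^+ 2) * k') ^+ 2 + (2%:J * s0 * s1 * k') ^+ 2 = 1.
    transitivity ((k * k') ^+ 2); last by rewrite kc expr1n.
    by rewrite /k rmorph_nat; ring.
  exact: norm_jone_le1.
have gk : (s0 ^+ 2 - s1 ^+ 2) * k' * k = s0 ^+ 2 - s1 ^+ 2.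
  by rewrite -mulrA (mulrC k') kc mulr1.
set g := (s0 ^+ 2 - s1 ^+ 2) * k' in gk *.
have -> : g * (s0 ^+ 2 + (c0%:J - v) + (s1 ^+ 2 - (c1%:J - v))) =
  g * k - (c1 - c0)%:J * g by rewrite /k !rmorphB; ring.
by rewrite gk rmorph_nat; ring.
Qed.

Lemma jpeirce_approx_eigenvector v (F : R -> set V) :
  (exists s, v = s ^+ 2) ->
  (forall d y, F d y -> val e *J y = 0) ->
  (forall d d' y, d <= d' -> F d y -> F d' y) ->
  (forall d a y, F d y -> F d (jpeirce e a y)) ->
  (forall d, 0 < d -> exists2 w, F d w & w <> 0) ->
  exists2 t, 0 <= t & forall d, 0 < d -> exists w, [/\ F d w, w <> 0 &
    exists2 b : jsub A, `|val b| <= d & jpeirce e (v - t%:J) w = jpeirce e b w].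
Proof.
move=> [s vE] Fker Fle Fmul Fex.
pose S := [set c : R | forall d, 0 < d -> exists w, [/\ F d w, w <> 0 &
  exists2 s, (s ^+ 2) ^+ 2 = (c%:J - v) ^+ 2 &
    jpeirce e (s ^+ 2 + (c%:J - v)) w = 0]].
have S0 : S 0.
  move=> d /Fex[w Fw w0]; exists w; split=> //; exists s; rewrite rmorph0 vE.
    by ring.
  by rewrite sub0r subrr jpeirce0.
have Sub (c : R) : S c -> c <= `|val v|.
  move=> /(_ 1 ltr01) [w [Fw w0 [r _ rw]]]; rewrite leNgt; apply/negP => vc.
  apply: w0.
  have [|h hE] := @jsub_sqrt _ _ A (`|val v|%:J - v) `|val v|.
    by rewrite subKr.
  have [u uE] := jsub_sqrD r (h ^+ 2).
  have [|x [xE _]] := @jsub_sqrD_inv _ _ A u (c - `|val v|).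
    by rewrite subr_gt0.
  apply: (jpeirce_unit_inj (Fker _ _ Fw) xE).
  rewrite -uE hE rmorphB -rw; congr jpeirce; ring.
have Ssup : has_sup S by split; [exists 0|exists `|val v| => c /Sub].
have t0 : 0 <= sup S by apply: ub_le_sup => //; case: Ssup.
exists (sup S) => // d d0; set t := sup S.
have d20 : 0 < d / 2 by rewrite divr_gt0.
have [c0 Sc0 tc0] := sup_adherent d20 Ssup.
have c0t : c0 <= t by apply: ub_le_sup => //; case: Ssup.
set c1 := t + d / 2.
have c01 : c0 < c1 by rewrite (le_lt_trans c0t)// ltrDl.
have nSc1 : ~ S c1.
  by move=> /(ub_le_sup Ssup.2); rewrite leNgt ltrDl d20.
move/existsNP : nSc1 => [d1 /not_implyP[d1_gt0 nSc1]].
have [|w [Fw w0 [s0 s0E s0w]]] := Sc0 (Num.min d d1).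
  by rewrite lt_min d0.
have [s1 s1E] := jsub_sqrt (jsub_sqr_bound (c1%:J - v)).
have ew := Fker _ _ Fw.
have s1w : jpeirce e (s1 ^+ 2 - (c1%:J - v)) w = 0.
  apply: contrapT => w'0; apply: nSc1.
  exists (jpeirce e (s1 ^+ 2 - (c1%:J - v)) w); split=> //.
    by apply/Fmul/Fle/Fw; rewrite ge_min lexx orbT.
  exists s1 => //; rewrite jpeirceM//.
  have -> : (s1 ^+ 2 + (c1%:J - v)) * (s1 ^+ 2 - (c1%:J - v)) =
    (s1 ^+ 2) ^+ 2 - (c1%:J - v) ^+ 2 by ring.
  by rewrite s1E subrr jpeirce0.
have [g [g1 gE]] := jsub_window c01 s0E s1E.
exists w; split=> //; first by apply: Fle Fw; rewrite ge_min lexx.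
exists ((2^-1)%:J * ((c1 - c0)%:J * g) + ((c0 + c1) / 2 - t)%:J).
  rewrite (le_trans (ler_normD _ _))// !jsub_normZ.
  rewrite ger0_norm // (ger0_norm (_ : 0 <= c1 - c0)) ?subr_ge0 ?(ltW c01)//.
  have cg : (c1 - c0) * `|val g| <= c1 - c0.
    by rewrite ler_piMr // subr_ge0 ltW.
  rewrite (le_trans (lerD (ler_wpM2l _ cg) (jsub_norm_scalar _ _)))//.
  rewrite (le_trans (lerD (lexx _) (_ : _ <= d / 4)))//.
    rewrite ler_norml /c1; apply/andP.
    by split; move: tc0 c0t d0; rewrite -/t; lra.
  by move: tc0 c0t d0; rewrite /c1 -/t; lra.
apply/eqP; rewrite -subr_eq0 -jpeirceN -jpeirceD; apply/eqP.
have half : (2^-1)%:J * 2%:J = 1 by rewrite -rmorphM mulVf ?rmorph1// pnatr_eq0.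
have -> : v - t%:J - ((2^-1)%:J * ((c1 - c0)%:J * g) + ((c0 + c1) / 2 - t)%:J) =
  (2^-1)%:J * (2%:J * v - (c0 + c1)%:J - (c1 - c0)%:J * g).
  have vE2 : v = (2^-1)%:J * (2%:J * v) by rewrite mulrA half mul1r.
  have halfE k : (k / 2)%:J = (2^-1)%:J * k%:J by rewrite -rmorphM mulrC.
  rewrite {1}vE2 !rmorphB /= halfE.
  by move: (2^-1)%:J => h; ring.
rewrite gE; apply: jpeirce_idealM => //.
move: (s0 ^+ 2 + _) (s1 ^+ 2 - _) s0w s1w => x1 x2 x1w x2w.
rewrite 2!jpeirceD jpeirceN x1w x2w oppr0 !addr0.
by rewrite jpeirce_idealM // jpeirceD x1w x2w addr0.
Qed.

End HalfSpace.

Section PositiveSpectrum.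
Context {R : realType} {V : jbAlgebraType R}.

Lemma jinvolution_central (e : V) : e *J e = jone ->
  (forall y, e *J y = 0 -> y = 0) -> central e.
Proof.
move=> ee einj.
have e2 y : e *J (e *J y) = y.
  apply/eqP; rewrite -subr_eq0; apply/eqP; apply: einj.
  have := jmul3 e e e y; rewrite ee !jmul1 jmulDr jmulNr => /eqP.
  rewrite -subr_eq0 => /eqP E.
  apply: (@scalerI R V 2); first by rewrite pnatr_eq0.
  by rewrite scaler0 -E; module_ring.
move=> w; apply/funext => y; rewrite /jL /comp.
have := jordan_linearized e e (e *J w) y.
rewrite ee !jmul1 subrr add0r (jmulC (e *J w) e) !e2 => E.
apply/esym/eqP; rewrite -subr_eq0; apply/eqP.
apply: (@scalerI R V 2); first by rewrite pnatr_eq0.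
by rewrite scaler0 -E; module_ring.
Qed.

Lemma invertible_operator_lower_bound (T : V -> V) : invertible_operator T ->
  exists2 M, 0 <= M & forall y, `|y| <= M * `|T y|.
Proof.
move=> [_ [S [[_ [M SM]] ST _]]]; exists `|M| => // y.
have {1}<- : S (T y) = y by have := congr1 (fun f => f y) ST.
by rewrite (le_trans (SM _))// ler_wpM2r// ler_norm.
Qed.

Context (A : @jassoc R V).
Implicit Types a b c s u v e : jsub A.

Local Notation "k %:J" := (jscalar A k) (at level 2, format "k %:J").

Lemma jU_half e v (w : V) : e ^+ 2 = 1 -> val e *J w = 0 ->
  jU (val (v * e)) w = - jpeirce e v (jpeirce (- e) v w).
Proof.
move=> e2 ew; have E := jmul_half (v * e) v ew.
have vv : (v * e) * (v * e) = v * e * v * e by ring.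
have vee : v * e * e = v by rewrite -mulrA -expr2 e2 mulr1.
rewrite /jU /jL -(jsub_valM (v * e)) vv E vee /jpeirce mulNr mulrC.
rewrite !(jsub_valD, jsub_valN) !jmulDl !jmulDr !jmulNl !jmulNr.
rewrite (@jcar_comm _ _ A _ _ w (jsubP v) (jsubP (e * v))).
by module_ring.
Qed.

Lemma ker_involution_eq0 e v : e ^+ 2 = 1 -> (exists s, v = s ^+ 2) ->
  operator_spectrum (jU (val (v * e))) `<=` `]0, +oo[ ->
  forall y : V, val e *J y = 0 -> y = 0.
Proof.
move=> e2 vsqr spec y ey; apply: contrapT => y0.
have Ne2 : (- e) ^+ 2 = 1 by rewrite sqrrN.
have Nker (w : V) : val (- e) *J w = 0 <-> val e *J w = 0.
  rewrite jsub_valN jmulNl; split=> [/eqP|->]; last by rewrite oppr0.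
  by rewrite oppr_eq0 => /eqP.
have [|||d _|t1 t1_ge0 ap1] := @jpeirce_approx_eigenvector _ _ A e e2 v
  (fun _ => [set w | val e *J w = 0]) vsqr.
- by [].
- by [].
- by move=> _ a w; apply: jpeirce_ker.
- by exists y.
have [|||d d0|t2 t2_ge0 ap2] := @jpeirce_approx_eigenvector _ _ A (- e) Ne2 v
  (fun d => [set w | val e *J w = 0 /\ exists2 b : jsub A, `|val b| <= d &
     jpeirce e (v - t1%:J) w = jpeirce e b w]) vsqr.
- by move=> d w [/Nker].
- move=> d d' w dd' [ew [b bd bE]]; split=> //; exists b => //.
  exact: le_trans dd'.
- move=> d a w [ew [b bd bE]]; split.
    by apply/Nker/jpeirce_ker/Nker.
  by exists b => //; rewrite !(jpeirceC e (- e)) bE.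
- have [w [ew w0 bw]] := ap1 d d0; exists w => //; split=> //.
have inv : invertible_operator
    (fun w => jU (val (v * e)) w - (- (t1 * t2)) *: w).
  apply: contrapT => /spec; rewrite /= in_itv/= andbT ltNge oppr_le0.
  by rewrite mulr_ge0.
have [M M0 MT] := invertible_operator_lower_bound inv.
set K := 2 * t1 + 2 * t2 + 4.
have K_ge0 : 0 <= K by rewrite !addr_ge0 ?mulr_ge0.
have MK : 0 < M * K + 1 by rewrite ltr_wpDl ?mulr_ge0.
set d := (M * K + 1)^-1; have d_gt0 : 0 < d by rewrite invr_gt0.
have d1 : d <= 1 by rewrite invf_le1// lerDr mulr_ge0.
have [w [[ew [b bd bE]] w0 [b' b'd b'E]]] := ap2 _ d_gt0.
have Dv : jpeirce e v w = t1 *: w + jpeirce e b w.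
  by rewrite -bE -(jpeirce_scalar t1 ew) -jpeirceD addrC subrK.
have Nscal k : jpeirce (- e) k%:J w = k *: w.
  by apply: jpeirce_scalar; apply/Nker.
have Ev : jpeirce (- e) v w = t2 *: w + jpeirce (- e) b' w.
  by rewrite -b'E -(Nscal t2) -jpeirceD addrC subrK.
have EDb : jpeirce (- e) v (jpeirce e b w) =
    t2 *: jpeirce e b w + jpeirce e b (jpeirce (- e) b' w).
  by rewrite -jpeirceC Ev jpeirceDr jpeirceZr.
have Uw : jU (val (v * e)) w - (- (t1 * t2)) *: w =
    - (t1 *: jpeirce (- e) b' w + (t2 *: jpeirce e b w +
       jpeirce e b (jpeirce (- e) b' w))).
  rewrite jU_half // jpeirceC Dv jpeirceDr jpeirceZr Ev EDb.
  by module_ring.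
have nb (z : V) : `|jpeirce e b z| <= 2 * d * `|z|.
  by rewrite (le_trans (jpeirce_norm e2 _ _))// ler_wpM2r// ler_wpM2l.
have nb' (z : V) : `|jpeirce (- e) b' z| <= 2 * d * `|z|.
  by rewrite (le_trans (jpeirce_norm Ne2 _ _))// ler_wpM2r// ler_wpM2l.
have w_gt0 : 0 < `|w| by rewrite normr_gt0; apply/eqP.
have UK : `|jU (val (v * e)) w - (- (t1 * t2)) *: w| <= K * d * `|w|.
  rewrite Uw normrN (le_trans (ler_normD _ _))// normrZ ger0_norm//.
  have n3 : `|jpeirce e b (jpeirce (- e) b' w)| <= 4 * d * `|w|.
    have d2_ge0 : 0 <= 2 * d by rewrite mulr_ge0 // ltW.
    rewrite (le_trans (nb _))// (le_trans (ler_wpM2l d2_ge0 (nb' _)))//.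
    have -> : 2 * d * (2 * d * `|w|) = 4 * d * `|w| * d by ring.
    by rewrite ler_piMr // !mulr_ge0 // ltW.
  have n2 : `|t2 *: jpeirce e b w| <= t2 * (2 * d * `|w|).
    by rewrite normrZ ger0_norm// ler_wpM2l.
  have n1 : t1 * `|jpeirce (- e) b' w| <= t1 * (2 * d * `|w|).
    by rewrite ler_wpM2l.
  rewrite (le_trans (lerD n1 (le_trans (ler_normD _ _) (lerD n2 n3))))//.
  by rewrite /K le_eqVlt; apply/orP; left; apply/eqP; ring.
have := le_trans (MT w) (ler_wpM2l M0 UK).
rewrite !mulrA -ler_pdivrMr// divff ?gt_eqF// leNgt => /negP; apply.
by rewrite /d ltr_pdivrMr// mul1r ltrDl.
Qed.

End PositiveSpectrum.

Theorem theorem2p33 (R : realType) (V : jbAlgebraType R) (x : V) :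
  operator_spectrum (jU x) `<=` `]0, +oo[ <->
  exists v e : V, [/\ positive_cone v, central_symmetry e & x = v *J e].
Proof.
split=> [spec|[v [e [vpos ecs ->]]]]; last first.
  have [A Av] := jassoc_exists v.
  have -> : jU (v *J e) = jU v.
    by apply/funext => y; exact: jU_mul_central_symmetry.
  exact: (@positive_jU_spectrum _ _ A (jsub_of Av)).
have [A Ax] := jassoc_exists x.
pose u : jsub A := jsub_of Ax.
have [c uc] : exists c, u * c = 1.
  have [_ [S [_ _ US]]] : invertible_operator (fun y => jU x y - 0 *: y).
    by apply: contrapT => /spec; rewrite /= in_itv/= ltxx.
  apply: (@jsub_inv_of_jU _ _ A u (S jone)).
  by have := congr1 (fun f => f jone) US; rewrite /= scale0r subr0.
have [s sE] := jsub_sqrt (jsub_sqr_bound u).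
pose v := s ^+ 2; pose e := u * v * c ^+ 2.
have vc : v * (v * c ^+ 2) = 1.
  by rewrite mulrA -expr2 sE -exprMn uc expr1n.
have e2 : e ^+ 2 = 1.
  have -> : e ^+ 2 = (u * c) ^+ 2 * (v * (v * c ^+ 2)) by rewrite /e; ring.
  by rewrite uc vc expr1n mulr1.
have ve : v * e = u.
  have -> : v * e = u * (v * (v * c ^+ 2)) by rewrite /e; ring.
  by rewrite vc mulr1.
exists (val v), (val e); split.
- apply/positive_cone_sub => t; rewrite le_eqVlt => /predU1P[<-|t0].
    by exists (v * c ^+ 2); rewrite rmorph0 addr0.
  by have [d [dE _]] := jsub_sqrD_inv s t0; exists d.
- have ecentral : central (val e).
    apply: jinvolution_central.
      by rewrite -(jsub_valM e) -expr2 e2.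
    apply: (ker_involution_eq0 e2 (v := v)); first by exists s.
    by rewrite ve.
  have half : 2 *: (2^-1 *: (val e + jone)) = val e + jone.
    by rewrite scalerA divff ?scale1r// pnatr_eq0.
  exists (2^-1 *: (val e + jone)); last by rewrite half addrK.
  split=> [w|].
    apply/funext => y; rewrite /jL /comp !jmulE.
    by have := congr1 (fun f => f y) (ecentral w); rewrite /jL /comp => ->.
  have ee : val e *J val e = jone by rewrite -(jsub_valM e) -expr2 e2.
  have ppE : val e + jone = 2^-1 *: ((val e + jone) *J (val e + jone)).
    rewrite !jmulE ee (_ : jone + _ + _ = 2 *: (val e + jone)).
      by rewrite scalerA mulVf ?scale1r// pnatr_eq0.
    by module_ring.
  by rewrite jmulZl jmulZr -ppE.
- by rewrite -(jsub_valM v) ve.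
Qed.
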